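(* Let $\alpha$ be an algebraic number of degree $d\in\{4,5,6,7\}$ over $\mathbb{Q}$ with $tr(\alpha)=0$, and denote by $p(x)$ the minimal polynomial of $\alpha$ over $\mathbb{Q}$. Suppose that some four distinct algebraic conjugates $\alpha_1,\alpha_2,\alpha_3,\alpha_4$ of $\alpha$ satisfy the relation $$\alpha_{1}+\alpha_{2}=\alpha_{3}+\alpha_{4}.$$ Then either $d=4$ or $d=6$. Moreover, the following statements are true. (i) If $d=4$, then $p(x)$ is an irreducible polynomial of the form $$p(x)=x^{4}+ax^{2}+b$$ for some $a,b\in\mathbb{Q}$. Conversely, for any irreducible polynomial $p(x)$ of this form (with $a,b\in\mathbb{Q}$), some four distinct roots $\alpha_1,\alpha_2,\alpha_3,\alpha_4$ of $p(x)$ satisfy $\alpha_{1}+\alpha_{2}=\alpha_{3}+\alpha_{4}$. (ii) Suppose that $d=6$ and the sum $\alpha_1+\alpha_2$ in the relation above is a rational number. Then $p(x)$ is an irreducible polynomial of the form $$p(x)=x^{6}+ax^{4}+bx^{2}+c$$ for some $a,b,c\in\mathbb{Q}$. Conversely, for any irreducible polynomial $p(x)$ of this form (with $a,b,c\in\mathbb{Q}$), some four distinct roots $\alpha_1,\alpha_2,\alpha_3,\alpha_4$ of $p(x)$ satisfy $\alpha_{1}+\alpha_{2}=\alpha_{3}+\alpha_{4}$. (iii) Suppose that $d=6$ and the sum $\alpha_1+\alpha_2$ in the relation above is not a rational number. Then $p(x)$ is an irreducible polynomial of the form $$p(x)=x^{6}+(2b-3a)x^{4}+2cx^{3}+(3a^{2}+b^{2})x^{2}+2c(3a+b)x-a^{3}-2a^{2}b-ab^{2}+c^{2}$$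 for some $a,b,c\in\mathbb{Q}$. Conversely, for any irreducible polynomial $p(x)$ of this form (with $a,b,c\in\mathbb{Q}$), some four distinct roots $\alpha_1,\alpha_2,\alpha_3,\alpha_4$ of $p(x)$ satisfy $\alpha_{1}+\alpha_{2}=\alpha_{3}+\alpha_{4}$.
   Context: Algebraic numbers, algebraic conjugates, degree, minimal polynomials and irreducibility are all over $\mathbb{Q}$. The algebraic conjugates of $\alpha$ (including $\alpha$ itself) are the $d$ distinct complex roots of its minimal polynomial over $\mathbb{Q}$. The trace $tr(\alpha)$ is the absolute trace, i.e. the sum of all $d$ algebraic conjugates of $\alpha$. *)

(* Defs.v *)
From HB Require Import structures.
From mathcomp Require Import all_boot all_order all_algebra all_field.

Set Implicit Arguments.
Unset Strict Implicit.
Unset Printing Implicit Defensive.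

Import Order.TTheory GRing.Theory Num.Theory.
Local Open Scope ring_scope.

Definition algdegree (alpha : algC) : nat := (size (minCpoly alpha)).-1.

Definition conjugates (alpha : algC) : seq algC :=
  sval (closed_field_poly_normal (minCpoly alpha)).

Definition abs_trace (alpha : algC) : algC := \sum_(z <- conjugates alpha) z.

Definition QtoC_poly (q : {poly rat}) : {poly algC} := map_poly ratr q.

Definition biquadratic (a b : rat) : {poly rat} :=
  'X^4 + a *: 'X^2 + b%:P.

Definition even_sextic (a b c : rat) : {poly rat} :=
  'X^6 + a *: 'X^4 + b *: 'X^2 + c%:P.

(* With s ^+ 2 = a, this is the product of (x + s)^3 + b (x + s) + c and
   (x - s)^3 + b (x - s) + c. *)
Definition split_sextic (a b c : rat) : {poly rat} :=
  'X^6 + (2 * b - 3 * a) *: 'X^4 + (2 * c) *: 'X^3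
  + (3 * a ^+ 2 + b ^+ 2) *: 'X^2 + (2 * c * (3 * a + b)) *: 'X
  + (- a ^+ 3 - 2 * a ^+ 2 * b - a * b ^+ 2 + c ^+ 2)%:P.

Lemma conjugatesE (alpha : algC) :
  minCpoly alpha = \prod_(z <- conjugates alpha) ('X - z%:P).
Proof.
rewrite /conjugates; case: closed_field_poly_normal => r /= {1}->.
by rewrite (monicP (minCpoly_monic alpha)) scale1r.
Qed.

Lemma mem_conjugates (alpha z : algC) :
  (z \in conjugates alpha) = root (minCpoly alpha) z.
Proof. by rewrite conjugatesE root_prod_XsubC. Qed.

Lemma size_conjugates (alpha : algC) :
  size (conjugates alpha) = algdegree alpha.
Proof. by rewrite /algdegree conjugatesE size_prod_XsubC. Qed.

(* The list of conjugates has no repetition, so abs_trace counts each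
   conjugate exactly once. *)
Lemma conjugates_uniq (alpha : algC) : uniq (conjugates alpha).
Proof.
rewrite -separable_prod_XsubC -conjugatesE.
have [p [Dp mon_p] min_p] := minCpolyP alpha.
rewrite Dp separable_map unlock.
have nz_p := monic_neq0 mon_p.
have p_gt1 : (1 < size p)%N
  by rewrite -(size_map_poly (ratr : rat -> algC)) -Dp size_minCpoly.
have nz_dp : p^`() != 0.
  apply/eqP=> /polyP/(_ (size p).-2); rewrite coef_deriv coef0.
  have ->: (size p).-2.+1 = (size p).-1 by case: (size p) p_gt1 => [|[]].
  rewrite -lead_coefE (monicP mon_p) => /eqP.
  by rewrite pnatr_eq0; case: (size p) p_gt1 => [|[]].
rewrite /coprimep; set g := gcdp p p^`().
have: ~~ root (map_poly ratr g) alpha.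
  rewrite min_p; apply/negP=> /dvdp_trans/(_ (dvdp_gcdr _ _)) /(dvdp_leq nz_dp).
  by rewrite leqNgt lt_size_deriv.
have /dvdpP[q Dq]: g %| p := dvdp_gcdl _ _.
move=> ng; have: root (map_poly ratr p) alpha by rewrite min_p dvdpp.
rewrite {1}Dq rmorphM /= rootM (negPf ng) orbF min_p => dv_q.
have nz_q : q != 0 by apply: contraNneq nz_p; rewrite Dq => ->; rewrite mul0r.
have nz_g : g != 0 by apply: contraNneq nz_p; rewrite Dq => ->; rewrite mulr0.
have := dvdp_leq nz_q dv_q; rewrite {1}Dq size_mul //.
have q_gt0 : (0 < size q)%N by rewrite lt0n size_poly_eq0.
have g_gt0 : (0 < size g)%N by rewrite lt0n size_poly_eq0.
case: (size q) q_gt0 => [|m] // _.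
case: (size g) g_gt0 => [|k] // _.
by rewrite addSn /= addnS ltnS -[leqRHS]addn0 leq_add2l leqn0.
Qed.

(* Main.v *)
(* Loaded first: conjugates below is the notion for algebraic numbers. *)
From mathcomp Require Import all_fingroup all_solvable.
Require Import Defs.
From HB Require Import structures.
From mathcomp Require Import all_boot all_order all_algebra all_field.
From mathcomp Require Import ring zify.

Set Implicit Arguments.
Unset Strict Implicit.
Unset Printing Implicit Defensive.

Import Order.TTheory GRing.Theory Num.Theory.
Local Open Scope ring_scope.

(** Every automorphism of the field of algebraic numbers permutes the
    conjugates of alpha, any conjugate can be sent to any other, and a number
    fixed by all automorphisms is rational ([conjugates_transitive],
    [aut_fixed_Crat]). Relations between conjugates are exploited by moving them
    around with these automorphisms.

    Degrees 5 and 7. For a prime degree p, Cauchy's theorem gives an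
    automorphism nu of order p, which moves the conjugates in a single cycle
    z, nu z, nu^2 z, and so on ([prime_degree_orbit]). The rational polynomials
    f for which f(nu) kills z form an ideal. It contains 1 + X + ... + X^(p-1),
    because the trace is 0, and the relation would put in it a nonzero f of
    degree less than p with f(1) = 0. These two polynomials are coprime since
    the first one is irreducible, so z would be 0
    ([prime_degree_no_relation]).

    Rational sum r = x1 + x2. Moving x1 around shows that the set of conjugates
    is stable under z |-> r - z, and the trace then forces r = 0: the conjugates
    are stable under negation and the minimal polynomial, of even degree, is
    even ([rational_sum_opp_closed], [opp_closed_odd_coef]). In degree 4 the
    trace gives x1 + x2 = 0, so this covers that case too.

    Irrational sum in degree 6. Call x and y mates when the four other
    conjugates split into two pairs of equal sum. A conjugate of maximal modulus
    shows that a conjugate is never the midpoint of two others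
    ([no_midpoint]), and this makes mates unique ([mate_uniq]); by transitivity
    the six conjugates fall into three pairs of mates. Any two of these pairs
    have the same sum or, up to sign, the same difference, but not both
    ([mates_dichotomy], [eq_sum_neq_diff]). Hence either all sums agree, and
    then they vanish and x1 + x2 is rational, or all squared differences agree
    ([sextic_equal_gaps]). In the second case the common value 4a is Galois
    invariant, hence rational, and the conjugates are m_i + s and m_i - s with
    s^2 = a and m_1 + m_2 + m_3 = 0. The minimal polynomial is then
    the displayed sextic, with X^3 + b X + c the monic cubic with roots m_i, and
    its coefficients of degree 4 and 3 show that b and c are rational
    ([sextic_split_form]).

    Conversely, the roots of an irreducible polynomial are the distinct
    conjugates of one of them. Two pairs of opposite roots, respectively the
    roots m_1 + s, m_2 - s, m_1 - s, m_2 + s, give the relation. *)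

(** * Duplicate-free sequences *)

Lemma perm_eq_extend (T : eqType) (s t : seq T) :
    uniq s -> uniq t -> {subset s <= t} ->
  exists2 r, perm_eq t (s ++ r) & size r = (size t - size s)%N.
Proof.
move=> uniq_s uniq_t sub_st; set r := [seq x <- t | x \notin s].
have perm_t: perm_eq t (s ++ r).
  apply: uniq_perm => // [|x].
    rewrite cat_uniq uniq_s filter_uniq // andbT /=.
    by apply/hasPn => x; rewrite mem_filter => /andP[].
  by rewrite mem_cat mem_filter; case: (boolP (x \in s)) => //= /sub_st.
by exists r; rewrite // (perm_size perm_t) size_cat addKn.
Qed.

Lemma perm_eq_sub (T : eqType) (s t : seq T) :
    uniq s -> uniq t -> {subset s <= t} -> (size t <= size s)%N ->
  perm_eq t s.
Proof.
move=> uniq_s uniq_t sub_st le_ts.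
have [r perm_t size_r] := perm_eq_extend uniq_s uniq_t sub_st.
have r0 : r = [::] by apply: size0nil; rewrite size_r; apply/eqP.
by rewrite r0 cats0 in perm_t.
Qed.

(** * Galois action on the conjugates *)

Lemma QtoC_alg (L : fieldExtType rat) (LC : {rmorphism L -> algC})
    (q : {poly rat}) :
  map_poly LC (map_poly (in_alg L) q) = QtoC_poly q.
Proof.
rewrite -map_poly_comp; apply: eq_map_poly => c /=.
by rewrite alg_num_field fmorph_rat.
Qed.

(** The minimal polynomial over Q is the same whether computed in a number field
    or among the algebraic numbers; this carries Galois theory of number fields
    over to conjugates. *)
Lemma minPoly_minCpoly (L : fieldExtType rat) (LC : {rmorphism L -> algC})
    (a : L) :
  map_poly LC (minPoly 1 a) = minCpoly (LC a).
Proof.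
have [q [Dq mon_q] min_q] := minCpolyP (LC a).
have over1 r: (map_poly (in_alg L) r) \is a polyOver 1%VS.
  by apply/polyOverP=> i; rewrite coef_map; apply: memvZ; apply: mem1v.
have [r Dr]: exists r, minPoly 1 a = map_poly (in_alg L) r.
  have /polyOverP aP := minPolyOver 1 a.
  have{aP} a_ i := sig_eqW (vlineP _ _ (aP i)).
  exists (\poly_(i < size (minPoly 1 a)) sval (a_ i)).
  apply/polyP=> i; rewrite coef_map coef_poly.
  case: ltnP => [_|le_i]; first by case: (a_ i).
  by rewrite nth_default //= scale0r.
apply/eqP; rewrite -eqp_monic ?map_monic ?monic_minPoly ?minCpoly_monic //.
apply/andP; split; last first.
  rewrite Dr QtoC_alg Dq dvdp_map -min_q -/(QtoC_poly r) -(QtoC_alg LC) -Dr.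
  by rewrite fmorph_root root_minPoly.
rewrite Dq -/(QtoC_poly q) -(QtoC_alg LC) dvdp_map minPoly_dvdp //.
by rewrite -(fmorph_root LC) QtoC_alg min_q.
Qed.

(** The Galois closure of alpha, generated by its conjugates. *)
Lemma conjugates_field (alpha : algC) :
  exists (L : splittingFieldType rat) (LC : {rmorphism L -> algC}) (s : seq L),
    map LC s = conjugates alpha /\ <<1 & s>>%VS = fullv.
Proof.
have [L [LC [s Ds genL]]] := num_field_exists (conjugates alpha).
have [q [Dq _] _] := minCpolyP alpha.
have splitL : SplittingField.axiom L.
  exists (map_poly (in_alg L) q).
    by apply/polyOverP=> i; rewrite coef_map; apply: memvZ; apply: mem1v.
  exists s => //; suff ->: map_poly (in_alg L) q = \prod_(z <- s) ('X - z%:P).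
    exact: eqpxx.
  apply: (map_poly_inj LC); rewrite QtoC_alg /QtoC_poly -Dq conjugatesE -Ds.
  rewrite big_map rmorph_prod.
  by apply: eq_bigr => z _; rewrite /= rmorphB /= map_polyX map_polyC.
pose L' : splittingFieldType rat :=
  HB.pack (FieldExt.sort L) (FieldExt_isSplittingField.Build _ _ splitL).
by exists L', LC, s; split.
Qed.

Lemma gal_extends (L : splittingFieldType rat) (LC : {rmorphism L -> algC})
    (g : gal_of {:L}) :
  exists nu : {rmorphism algC -> algC}, forall x, nu (LC x) = LC (g x).
Proof.
have [nu Dnu] := extend_algC_subfield_aut LC (gal_repr g : {rmorphism L -> L}).
by exists nu => x; rewrite -Dnu.
Qed.

Lemma conjugates_eq (alpha z : algC) :
  z \in conjugates alpha -> minCpoly z = minCpoly alpha.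
Proof.
rewrite mem_conjugates => z_root.
have [L [LC [s [Ds _]]]] := conjugates_field alpha.
have [a Da]: exists a, LC a = alpha.
  have: alpha \in conjugates alpha by rewrite mem_conjugates root_minCpoly.
  by rewrite -Ds => /mapP[a _ ->]; exists a.
have [b Db]: exists b, LC b = z.
  by move: z_root; rewrite -mem_conjugates -Ds => /mapP[b _ ->]; exists b.
move: z_root; rewrite -Da -Db -minPoly_minCpoly fmorph_root => b_root.
have [|g _ <-] :=
    normalField_root_minPoly (sub1v _) (normalFieldf 1) _ b_root.
  exact: memvf.
by have [nu <-] := gal_extends LC g; rewrite minCpoly_aut minPoly_minCpoly.
Qed.

Lemma conjugates_transitive (alpha x y : algC) :
    x \in conjugates alpha -> y \in conjugates alpha ->
  exists nu : {rmorphism algC -> algC}, nu x = y.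
Proof.
move=> cx; have := cx; have [L [LC [s [Ds _]]]] := conjugates_field alpha.
rewrite -{1}Ds => /mapP[a _ Dx]; move=> cy; have := cy.
rewrite -Ds => /mapP[b _ Dy].
have b_root: root (minPoly 1 a) b.
  rewrite -(fmorph_root LC) minPoly_minCpoly -Dx -Dy.
  by rewrite (conjugates_eq cx) -mem_conjugates.
have [|g _ Dg] :=
    normalField_root_minPoly (sub1v _) (normalFieldf 1) _ b_root.
  exact: memvf.
have [nu Dnu] := gal_extends LC g.
by exists nu; rewrite Dx Dnu Dg -Dy.
Qed.

Lemma aut_conjugates (alpha : algC) (nu : {rmorphism algC -> algC}) :
  {homo nu : x / x \in conjugates alpha}.
Proof.
move=> x cx; rewrite mem_conjugates -(conjugates_eq cx) -(minCpoly_aut nu).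
exact: root_minCpoly.
Qed.

(** By transitivity a fixed number is its only conjugate and, conjugates being
    distinct, its minimal polynomial has degree 1. *)
Lemma aut_fixed_Crat (x : algC) :
  (forall nu : {rmorphism algC -> algC}, nu x = x) -> x \in Crat.
Proof.
move=> fix_x.
have cx: x \in conjugates x by rewrite mem_conjugates root_minCpoly.
have all_x y: y \in conjugates x -> y = x.
  by move=> cy; have [nu <-] := conjugates_transitive cx cy.
have size1: conjugates x = [:: x].
  have := conjugates_uniq x; move: cx all_x.
  elim/last_ind: (conjugates x) => // [[|u s] v _] //= cx all_x.
    by rewrite (all_x v) // mem_head.
  have ->: u = x by apply: all_x; rewrite mem_head.
  have ->: v = x by apply: all_x; rewrite inE mem_rcons mem_head orbT.
  by rewrite mem_rcons mem_head.
have [p [Dp _] _] := minCpolyP x.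
have := conjugatesE x; rewrite size1 big_seq1 Dp => /polyP/(_ 0).
rewrite coef_map coefB coefX coefC sub0r /= => Dx.
by rewrite -[x]opprK -Dx rpredN Crat_rat.
Qed.

(** Move z to a conjugate w of maximal modulus: then w is the midpoint of two
    points of the closed disc of radius |w|, which is possible only if they
    coincide. *)
Lemma no_midpoint (alpha x y z : algC) :
    {subset [:: x; y; z] <= conjugates alpha} -> x + y = 2 * z -> x = y.
Proof.
move=> sub Dz.
have cz: z \in conjugates alpha by rewrite sub // !inE eqxx ?orbT.
have [w cw max_w]: exists2 w, w \in conjugates alpha &
    {in conjugates alpha, forall u, `|u| <= `|w|}.
  elim: (conjugates alpha) (z) cz => //= u s IHs v _.
  case: s IHs => [_|t s IHs].
    by exists u; rewrite ?inE ?eqxx // => v'; rewrite inE => /eqP->.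
  have [|w sw max_w] := IHs t; first by rewrite inE eqxx.
  have := real_leVge (normr_real u) (normr_real w).
  case/orP => [le_uw | le_wu].
    exists w; first by rewrite inE sw orbT.
    by move=> v'; rewrite inE => /predU1P[-> | /max_w].
  exists u; first by rewrite inE eqxx.
  by move=> v'; rewrite inE => /predU1P[-> // | /max_w /le_trans]; apply.
have [nu Dnu] := conjugates_transitive cz cw.
have cx: x \in conjugates alpha by rewrite sub // !inE eqxx ?orbT.
have cy: y \in conjugates alpha by rewrite sub // !inE eqxx ?orbT.
have nu_le u: u \in conjugates alpha -> `|nu u| <= `|w|.
  by move=> cu; apply/max_w/aut_conjugates.
move: (nu_le _ cx) (nu_le _ cy) => le_x le_y.
have Dw : nu x + nu y = w + w.
  by rewrite -rmorphD Dz rmorphM /= rmorph_nat Dnu mulr2n mulrDl mul1r.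
suff: nu x = nu y by apply: fmorph_inj.
(* The points are w + e and w - e; the parallelogram law forces e = 0. *)
pose e := nu x - w.
have Dnx: nu x = w + e by rewrite /e addrC subrK.
have Dny: nu y = w - e by apply: (addrI (nu x)); rewrite Dw Dnx; ring.
have: `|nu x| ^+ 2 + `|nu y| ^+ 2 <= `|w| ^+ 2 + `|w| ^+ 2.
  by rewrite lerD // lerXn2r ?nnegrE.
have ->: `|nu x| ^+ 2 + `|nu y| ^+ 2 = `|w| ^+ 2 + `|w| ^+ 2 + `|e| ^+ 2 *+ 2.
  by rewrite Dnx Dny !normCK !(rmorphD, rmorphN) /=; ring.
rewrite gerDl pmulrn_lle0 // => /(conj (exprn_ge0 2 (normr_ge0 e))) /andP.
rewrite -eq_le eq_sym expf_eq0 normr_eq0 /= => /eqP e0.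
by rewrite Dnx Dny e0 subr0 addr0.
Qed.

(** * Prime degree *)

Section OrbitRelations.

Variables (nu : {rmorphism algC -> algC}) (z : algC).

(** The value at z of the polynomial q in the operator nu. *)
Definition orbit_eval (q : {poly rat}) : algC :=
  \sum_(i < size q) ratr q`_i * iter i nu z.

Lemma orbit_eval_wide n (q : {poly rat}) : (size q <= n)%N ->
  orbit_eval q = \sum_(i < n) ratr q`_i * iter i nu z.
Proof.
move=> le_n; rewrite /orbit_eval.
rewrite (big_ord_widen _ (fun i => ratr q`_i * iter i nu z) le_n) big_mkcond.
apply: eq_bigr => i _.
by case: ltnP => // /(nth_default 0)->; rewrite rmorph0 mul0r.
Qed.

Lemma orbit_evalD q r : orbit_eval (q + r) = orbit_eval q + orbit_eval r.
Proof.
pose n := maxn (size (q + r)) (maxn (size q) (size r)).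
rewrite !(@orbit_eval_wide n) ?leq_max ?leqnn ?orbT // -big_split /=.
by apply: eq_bigr => i _; rewrite coefD rmorphD mulrDl.
Qed.

Lemma orbit_evalZ (c : rat) (q : {poly rat}) :
  orbit_eval (c *: q) = ratr c * orbit_eval q.
Proof.
rewrite (orbit_eval_wide (size_scale_leq c q)) mulr_sumr.
by apply: eq_bigr => i _; rewrite coefZ rmorphM mulrA.
Qed.

Lemma orbit_evalXn n : orbit_eval 'X^n = iter n nu z.
Proof.
rewrite (@orbit_eval_wide n.+1) ?size_polyXn // big_ord_recr /=.
rewrite big1 => [|i _]; last by rewrite coefXn ltn_eqF ?rmorph0 ?mul0r.
by rewrite coefXn eqxx rmorph1 mul1r add0r.
Qed.

Lemma orbit_evalMX q : orbit_eval (q * 'X) = nu (orbit_eval q).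
Proof.
rewrite (@orbit_eval_wide (size q).+1); last first.
  by apply: leq_trans (size_polyMleq _ _) _; rewrite size_polyX addn2.
rewrite big_ord_recl coefMX eqxx rmorph0 mul0r add0r rmorph_sum /=.
by apply: eq_bigr => i _; rewrite rmorphM /= fmorph_rat coefMX.
Qed.

(** The polynomials killing z form an ideal, as nu is linear over Q. *)
Lemma orbit_eval_mull r q : orbit_eval q = 0 -> orbit_eval (r * q) = 0.
Proof.
move=> q0; elim/poly_ind: r => [|r c IHr].
  by rewrite mul0r -(scale0r 0) orbit_evalZ rmorph0 mul0r.
rewrite mulrDl mulrAC orbit_evalD orbit_evalMX IHr rmorph0.
by rewrite mul_polyC orbit_evalZ q0 mulr0 addr0.
Qed.

Lemma orbit_eval_coprime q r :
  coprimep q r -> orbit_eval q = 0 -> orbit_eval r = 0 -> z = 0.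
Proof.
move=> /Bezout_eq1_coprimepP[[u v] /= Duv] q0 r0.
have <-: orbit_eval 1 = z by rewrite -(expr0 'X) orbit_evalXn.
by rewrite -Duv orbit_evalD !orbit_eval_mull ?addr0.
Qed.

End OrbitRelations.

(** A common root w would be a primitive p-th root of unity, of degree p - 1;
    so f would be a scalar multiple of 1 + X + ... + X^(p-1), which does not
    vanish at 1. *)
Lemma coprime_prime_cyclotomic (p : nat) (f : {poly rat}) :
    prime p -> f != 0 -> (size f <= p)%N -> f.[1] = 0 ->
  coprimep f (\sum_(i < p) 'X^i).
Proof.
move=> p_pr nz_f le_fp f1; set Phi := \sum_(i < p) 'X^i.
have Phi1: Phi.[1] = p%:R.
  rewrite horner_sum (eq_bigr (fun=> 1)) ?sumr_const ?card_ord // => i _.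
  by rewrite hornerXn expr1n.
rewrite -(coprimep_map (ratr : {rmorphism rat -> algC})).
apply: Pdiv.ClosedField.root_coprimep => w fw; apply/negP => Pw.
have w_p: w ^+ p = 1.
  apply/eqP; rewrite -subr_eq0; rewrite subrX1.
  have ->: \sum_(i < p) w ^+ i = (map_poly ratr Phi).[w].
    rewrite rmorph_sum horner_sum; apply: eq_bigr => i _.
    by rewrite /= map_polyXn hornerXn.
  by rewrite (eqP Pw) mulr0.
have [m prim_w m_p] := prim_order_exists (prime_gt0 p_pr) w_p.
have Dm: m = p.
  have /primeP[_ /(_ m m_p)/predU1P[m1 | /eqP//]] := p_pr.
  move: Pw; rewrite m1 in prim_w; have:= prim_expr_order prim_w.
  rewrite expr1 => ->; rewrite -(rmorph1 (ratr : {rmorphism rat -> algC})).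
  by rewrite horner_map Phi1 rmorph_nat pnatr_eq0 eqn0Ngt prime_gt0.
rewrite Dm in prim_w.
have [q [Dq mon_q] min_q] := minCpolyP w.
have sz_q: size q = p.
  rewrite -(size_map_poly (ratr : {rmorphism rat -> algC})) -Dq.
  rewrite (minCpoly_cyclotomic prim_w) size_cyclotomic totient_prime //.
  by rewrite prednK ?prime_gt0.
have q_f : q %= f.
  rewrite -dvdp_size_eqp -?min_q // sz_q; apply/eqP/anti_leq.
  by rewrite le_fp -{1}sz_q dvdp_leq // -min_q.
have: q %| Phi by rewrite -min_q.
rewrite (eqp_dvdl _ q_f) => /dvdpP[h Dh].
have := Phi1; rewrite Dh hornerM f1 mulr0 => /eqP; rewrite eq_sym pnatr_eq0.
by case: (p) (prime_gt0 p_pr).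
Qed.

(** The degree p divides the order of the Galois group, so Cauchy's theorem
    gives an element g of order p. It moves some conjugate a, and the orbit of a
    under g has p elements. *)
Lemma prime_degree_orbit (alpha : algC) :
    prime (algdegree alpha) ->
  exists (nu : {rmorphism algC -> algC}) (z : algC),
    perm_eq (conjugates alpha)
      [seq iter i nu z | i <- iota 0 (algdegree alpha)].
Proof.
set p := algdegree alpha => p_pr.
have [L [LC [s [Ds genL]]]] := conjugates_field alpha.
have galL: galois 1 {:L}.
  apply/and3P; split; [exact: sub1v | | exact: normalFieldf].
  apply/separableP => y _; apply: pcharf0_separable.
  exact: ftrans (pchar_lalg L) (pchar_num _).
have sz_s : size s = p by rewrite -(size_map LC) Ds size_conjugates.
have p_G: (p %| #|'Gal({:L} / 1)%g|)%N.
  rewrite -galois_dim // dimv1 divn1.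
  have [a Da]: exists a, LC a = alpha.
    have: alpha \in conjugates alpha by rewrite mem_conjugates root_minCpoly.
    by rewrite -Ds => /mapP[a _ ->]; exists a.
  have <-: \dim <<1; a>> = p.
    rewrite dim_Fadjoin dimv1 muln1 /p /algdegree -Da -minPoly_minCpoly.
    by rewrite size_map_poly size_minPoly.
  exact: field_dimS (subvf _).
have [g _ og] := Cauchy p_pr p_G.
have [nu Dnu] := gal_extends LC g.
have DnuX i x: iter i nu (LC x) = LC ((g ^+ i)%g x).
  elim: i => [|i IHi]; first by rewrite expg0 gal_id.
  by rewrite iterS IHi Dnu expgSr galM ?memvf.
have [a sa ga]: exists2 a, a \in s & g a != a.
  apply/hasP; rewrite -[has _ _]negbK -all_predC; apply/negP => /allP fix_s.
  suff g1: g = 1%g by rewrite g1 order1 in og; rewrite -og in p_pr.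
  apply/eqP/gal_eqP => x _; rewrite gal_id.
  suff /fixedFieldP: x \in fixedField [set g].
    by move/(_ (memvf _)) => /(_ g (set11 g)).
  have: x \in <<1 & s>>%VS by rewrite genL memvf.
  apply/subvP/Fadjoin_seqP; split; first exact: sub1v.
  move=> b /fix_s /= /negPn/eqP gb.
  by apply/fixedFieldP; rewrite ?memvf // => h /set1P->.
exists nu, (LC a).
have iter_inj i : injective (iter i nu).
  by elim: i => //= i IHi x y /fmorph_inj/IHi.
have iter_fix k m : iter k nu (LC a) = LC a -> iter (m * k) nu (LC a) = LC a.
  by move=> fix_k; elim: m => // m IHm; rewrite mulSn iterD IHm.
have fix_p: iter p nu (LC a) = LC a by rewrite DnuX -og expg_order gal_id.
have uniq_orb: uniq [seq iter i nu (LC a) | i <- iota 0 p].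
  rewrite map_inj_in_uniq ?iota_uniq // => i j.
  wlog le_ij: i j / (i <= j)%N => [IH|].
    by case/orP: (leq_total i j) => ? ? ? ?; [|symmetry]; apply: IH.
  rewrite !mem_iota !add0n /= => _ lt_jp; rewrite -(subnKC le_ij) iterD.
  move/iter_inj/esym => fix_k; have [k0 | k_gt0] := posnP (j - i).
    by rewrite k0 addn0.
  case/eqP: ga; apply: (fmorph_inj LC); rewrite -Dnu.
  (* Both nu^p and nu^(j-i) fix a, hence so does nu, by Bezout. *)
  have cop: coprime (j - i) p.
    rewrite coprime_sym prime_coprime // gtnNdvd //.
    exact: leq_ltn_trans (leq_subr _ _) lt_jp.
  have [km kn Dk _] := egcdnP p k_gt0.
  rewrite (eqP cop) addn1 in Dk.
  by have := iter_fix _ km fix_k; rewrite Dk iterS iter_fix.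
apply: perm_eq_sub; rewrite ?conjugates_uniq //.
  move=> _ /mapP[i _ ->]; elim: i => /= [|i IHi]; first by rewrite -Ds map_f.
  exact: aut_conjugates.
by rewrite size_conjugates size_map size_iota.
Qed.

Lemma prime_degree_no_relation (alpha x1 x2 x3 x4 : algC) :
    prime (algdegree alpha) -> abs_trace alpha = 0 ->
    uniq [:: x1; x2; x3; x4] ->
    {subset [:: x1; x2; x3; x4] <= conjugates alpha} ->
  x1 + x2 <> x3 + x4.
Proof.
move=> p_pr tr0 uniq_x sub_x Dx.
have [nu [z perm_z]] := prime_degree_orbit p_pr.
set p := algdegree alpha in p_pr perm_z.
have ix x: x \in [:: x1; x2; x3; x4] -> exists2 i, (i < p)%N & x = iter i nu z.
  move/sub_x; rewrite (perm_mem perm_z) => /mapP[i].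
  by rewrite mem_iota => /andP[_ lt_i]; exists i.
have [|i1 lt1 D1] := ix x1; first by rewrite !inE eqxx ?orbT.
have [|i2 lt2 D2] := ix x2; first by rewrite !inE eqxx ?orbT.
have [|i3 lt3 D3] := ix x3; first by rewrite !inE eqxx ?orbT.
have [|i4 lt4 D4] := ix x4; first by rewrite !inE eqxx ?orbT.
pose f : {poly rat} := 'X^i1 + 'X^i2 - 'X^i3 - 'X^i4.
have neq i j: iter i nu z != iter j nu z -> (i == j) = false.
  by apply: contraNF => /eqP->.
have: uniq [:: x1; x2; x3; x4] by [].
rewrite /= !inE !negb_or D1 D2 D3 D4 => /andP[/and3P[n12 n13 n14] _].
have nz_f: f != 0.
  apply/eqP => /polyP/(_ i1)/eqP; rewrite /f !(coefB, coefD, coefXn) coef0 eqxx.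
  by rewrite (neq _ _ n12) (neq _ _ n13) (neq _ _ n14).
have f1: f.[1] = 0 by rewrite /f !hornerE !expr1n; ring.
have sz_f: (size f <= p)%N.
  apply/leq_sizeP => j le_pj; rewrite /f !(coefB, coefD, coefXn).
  by rewrite !gtn_eqF ?(leq_trans _ le_pj) // addr0 !subr0.
have eval_f: orbit_eval nu z f = 0.
  rewrite /f -!scaleN1r !(orbit_evalD, orbit_evalZ) !orbit_evalXn.
  by rewrite -D1 -D2 -D3 -D4 Dx rmorphN rmorph1; ring.
have eval_Phi: orbit_eval nu z (\sum_(i < p) 'X^i) = 0.
  rewrite (big_morph _ (orbit_evalD nu z) (id1 := 0)); last first.
    by rewrite /orbit_eval size_poly0 big_ord0.
  transitivity (\sum_(0 <= i < p) iter i nu z).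
    by rewrite big_mkord; apply: eq_bigr => i _; rewrite orbit_evalXn.
  by rewrite -[RHS]tr0 /abs_trace (perm_big _ perm_z) big_map /index_iota subn0.
have co_f := coprime_prime_cyclotomic p_pr nz_f sz_f f1.
have z0 := orbit_eval_coprime co_f eval_f eval_Phi.
have iter0 i : iter i nu z = 0.
  by rewrite z0; elim: i => //= i ->; rewrite rmorph0.
by rewrite !iter0 eqxx in n12.
Qed.

(** * Rational polynomials and their roots *)

Lemma minCpoly_irreducible (alpha : algC) (q : {poly rat}) :
  minCpoly alpha = QtoC_poly q -> irreducible_poly q.
Proof.
have [p [Dp mon_p] min_p] := minCpolyP alpha.
rewrite Dp => /map_poly_inj <-{q}; have nz_p := monic_neq0 mon_p.
split.
  rewrite -(size_map_poly (ratr : {rmorphism rat -> algC})) -Dp.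
  exact: size_minCpoly.
move=> r size_r /dvdpP[h Dh].
have nz_r : r != 0 by apply: contraNneq nz_p; rewrite Dh => ->; rewrite mulr0.
have nz_h : h != 0 by apply: contraNneq nz_p; rewrite Dh => ->; rewrite mul0r.
have: root (QtoC_poly p) alpha by rewrite min_p dvdpp.
rewrite Dh /QtoC_poly rmorphM /= rootM !min_p => /orP[p_h | p_r].
  case/negP: size_r; have := dvdp_leq nz_h p_h; rewrite {1}Dh size_mul //.
  rewrite -size_poly_gt0 in nz_r; have nz_h' := nz_h.
  rewrite -size_poly_gt0 in nz_h'; case: (size r) nz_r => // n _.
  by rewrite addnS /= -[leqRHS]addn0 leq_add2l leqn0 => /eqP->.
by rewrite /eqp -Dh p_r andbT Dh dvdp_mull.
Qed.

Lemma irreducible_minCpoly (q : {poly rat}) :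
    irreducible_poly q -> q \is monic ->
  exists alpha, minCpoly alpha = QtoC_poly q.
Proof.
move=> irr_q mon_q; have [|alpha q_alpha] := closed_rootP (QtoC_poly q) _.
  by rewrite size_map_poly gtn_eqF ?irr_q.1.
exists alpha; have [p [-> mon_p] min_p] := minCpolyP alpha.
congr (map_poly _ _); apply/eqP; rewrite -eqp_monic //.
apply: irr_q; last by rewrite -min_p.
rewrite gtn_eqF // -(size_map_poly (ratr : {rmorphism rat -> algC})).
apply: root_size_gt1 (_ : root _ alpha); last by rewrite min_p.
by rewrite map_poly_eq0 monic_neq0.
Qed.

(** Substituting -X turns each factor X - z into -(X - (-z)), and the number of
    factors is even. *)
Lemma opp_closed_comp (alpha : algC) :
    ~~ odd (algdegree alpha) ->
    {homo -%R : x / x \in conjugates alpha} ->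
  minCpoly alpha \Po (- 'X) = minCpoly alpha.
Proof.
move=> even_d opp_c; rewrite conjugatesE rmorph_prod /=.
have perm_opp: perm_eq (conjugates alpha) (map -%R (conjugates alpha)).
  apply: perm_eq_sub; rewrite ?conjugates_uniq ?size_map //.
    by rewrite map_inj_uniq ?conjugates_uniq //; apply: oppr_inj.
  by move=> _ /mapP[x cx ->]; apply: opp_c.
rewrite [RHS](perm_big _ perm_opp) big_map /=.
have ->: \prod_(z <- conjugates alpha) (('X - z%:P) \Po - 'X) =
         \prod_(z <- conjugates alpha) (- 1 * ('X - (- z)%:P)).
  apply: eq_bigr => z _.
  by rewrite comp_polyB comp_polyX comp_polyC polyCN; ring.
rewrite big_split /= big_const_seq count_predT size_conjugates.
by rewrite iter_mulr_1 -signr_odd (negPf even_d) expr0 mul1r.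
Qed.

Lemma opp_closed_odd_coef (alpha : algC) (q : {poly rat}) (i : nat) :
    ~~ odd (algdegree alpha) ->
    {homo -%R : x / x \in conjugates alpha} ->
    minCpoly alpha = QtoC_poly q -> odd i ->
  q`_i = 0.
Proof.
move=> even_d opp_c Dq odd_i.
apply: (fmorph_inj (ratr : {rmorphism rat -> algC})).
rewrite rmorph0 -coef_map -/(QtoC_poly q) -Dq.
set P := minCpoly alpha; have: (P \Po (- 'X))`_i = - P`_i.
  rewrite comp_polyE coef_sum.
  have Pj (j : 'I_(size P)) :
      (P`_j *: (- 'X) ^+ j)`_i = if i == j then - P`_j else 0.
    have ->: (- 'X : {poly algC}) ^+ j = (-1) ^+ j *: 'X^j.
      by rewrite -scaleN1r exprZn.
    rewrite !coefZ coefXn; have [<-|_] := eqVneq i j; last by rewrite !mulr0.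
    by rewrite -signr_odd odd_i expr1 mulr1 mulrN1.
  rewrite (eq_bigr _ (fun j _ => Pj j)) -big_mkcond /=.
  have [le_Pi | lt_iP] := leqP (size P) i.
    rewrite big1 ?nth_default ?oppr0 // => j /eqP Dj.
    by have := ltn_ord j; rewrite -Dj ltnNge le_Pi.
  by rewrite (big_pred1 (Ordinal lt_iP)).
rewrite opp_closed_comp // => /eqP; rewrite -addr_eq0 -mulr2n mulrn_eq0 /=.
by move/eqP.
Qed.

(** * Pairing the six conjugates *)

Section SexticMates.

Variable alpha : algC.
Hypothesis deg6 : algdegree alpha = 6%N.
Hypothesis tr0 : abs_trace alpha = 0.

Local Notation X := (conjugates alpha).

(** As the trace is 0, the equation says that a + b is equal to the sum of the
    two remaining conjugates: the complement of x and y splits into two pairs of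
    equal sum. In this form the two remaining conjugates need not be named. *)
Definition mate (x y : algC) : Prop :=
  exists a b : algC, [/\ uniq [:: x; y; a; b],
    {subset [:: x; y; a; b] <= X} & x + y + 2 * (a + b) = 0].

Lemma sextic_complete (x y a b : algC) :
    uniq [:: x; y; a; b] -> {subset [:: x; y; a; b] <= X} ->
  exists c d, perm_eq X [:: x; y; a; b; c; d].
Proof.
move=> uniq_s /(perm_eq_extend uniq_s (conjugates_uniq _))[r].
rewrite size_conjugates deg6; case: r => [|c [|d []]] //= perm_X _.
by exists c, d.
Qed.

Lemma sextic_sum (x y a b c d : algC) :
  perm_eq X [:: x; y; a; b; c; d] -> x + y + a + b + c + d = 0.
Proof.
move=> perm_X; rewrite -[RHS]tr0 /abs_trace (perm_big _ perm_X).
by rewrite !big_cons big_nil /=; ring.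
Qed.

Lemma mateC (x y : algC) : mate x y -> mate y x.
Proof.
have swap (s : seq algC) : perm_eq (y :: x :: s) (x :: y :: s).
  by apply/permP=> P /=; lia.
move=> [a [b [uniq_s sub_s sum_s]]]; exists a, b.
split; first by rewrite (perm_uniq (swap _)).
  by move=> t; rewrite (perm_mem (swap _)) => /sub_s.
by rewrite [y + x]addrC.
Qed.

Lemma mate_aut (nu : {rmorphism algC -> algC}) (x y : algC) :
  mate x y -> mate (nu x) (nu y).
Proof.
move=> [a [b [uniq_s sub_s sum_s]]]; exists (nu a), (nu b); split.
- rewrite -[[:: _; _; _; _]]/(map nu [:: x; y; a; b]).
  by rewrite (map_inj_uniq (fmorph_inj nu)).
- move=> _ /(mapP (s := [:: x; y; a; b]))[t /sub_s ct ->].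
  exact: aut_conjugates.
- by rewrite -!rmorphD -[2](rmorph_nat nu) -rmorphM -rmorphD sum_s rmorph0.
Qed.

(** Suppose that x had two mates. The complements of the two pairs then share
    three conjugates, and comparing the two equations of sums shows either that
    the mates coincide or that a conjugate is the midpoint of the mates. *)
Lemma mate_uniq (x y z : algC) : mate x y -> mate x z -> y = z.
Proof.
move=> [a [b [uniq_s sub_s sum_s]]] mate_xz.
have [c [d perm_X]] := sextic_complete uniq_s sub_s.
apply/eqP; apply: contraT => ne_yz.
(* Any of a, b, c, d can play the role of a1, since c + d = a + b. *)
have no_mate a1 b1 c1 d1 : perm_eq X [:: x; y; a1; b1; c1; d1] ->
    x + y + 2 * (a1 + b1) = 0 -> ~ mate x a1.
  move=> {a b c d uniq_s sub_s sum_s perm_X} perm_X h0.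
  move=> [u [v [uniq_s sub_s h1]]].
  have hs := sextic_sum perm_X.
  have uniq_X := conjugates_uniq alpha; rewrite (perm_uniq perm_X) in uniq_X.
  have memX t : t \in [:: x; y; a1; b1; c1; d1] -> t \in X.
    by rewrite (perm_mem perm_X).
  have ne_ya : y <> a1.
    by move=> Dy; move: uniq_X; rewrite Dy /= !inE eqxx /= andbF.
  have dich : [\/ y - a1 = 0, y + a1 - 2 * c1 = 0 | y + a1 - 2 * d1 = 0].
    have comb (k0 k1 k2 A0 A1 A2 e : algC) :
        A0 = 0 -> A1 = 0 -> A2 = 0 -> e = k0 * A0 + k1 * A1 + k2 * A2 -> e = 0.
      by move=> -> -> -> ->; rewrite !mulr0 !addr0.
    have mu: u \in X by rewrite sub_s // !inE eqxx ?orbT.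
    have mv: v \in X by rewrite sub_s // !inE eqxx ?orbT.
    rewrite (perm_mem perm_X) !inE in mu; rewrite (perm_mem perm_X) !inE in mv.
    move: uniq_s; rewrite /= !inE !negb_or.
    move=> /and4P[/and3P[nxa nxu nxv] /andP[nau nav] nuv _].
    rewrite eq_sym in nxu; rewrite eq_sym in nxv.
    rewrite eq_sym in nau; rewrite eq_sym in nav.
    rewrite (negPf nxu) (negPf nau) /= in mu.
    rewrite (negPf nxv) (negPf nav) /= in mv.
    (* u and v are two of y, b1, c1, d1; each case is a fixed linear combination
       of the three equations h0, h1, hs. *)
    case/or4P: mu => /eqP Du; case/or4P: mv => /eqP Dv;
      rewrite Du Dv ?eqxx // in nuv h1.
    - by apply: Or31; apply: (comb (-1) (1) (0)) h0 h1 hs _; ring.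
    - by apply: Or33; apply: (comb (1) (1) (-2)) h0 h1 hs _; ring.
    - by apply: Or32; apply: (comb (1) (1) (-2)) h0 h1 hs _; ring.
    - by apply: Or31; apply: (comb (-1) (1) (0)) h0 h1 hs _; ring.
    - by apply: Or32; apply: (comb (1) (-1) (0)) h0 h1 hs _; ring.
    - by apply: Or33; apply: (comb (1) (-1) (0)) h0 h1 hs _; ring.
    - by apply: Or33; apply: (comb (1) (1) (-2)) h0 h1 hs _; ring.
    - by apply: Or32; apply: (comb (1) (-1) (0)) h0 h1 hs _; ring.
    - by apply: Or31; apply: (comb (-1) (-1) (2)) h0 h1 hs _; ring.
    - by apply: Or32; apply: (comb (1) (1) (-2)) h0 h1 hs _; ring.
    - by apply: Or33; apply: (comb (1) (-1) (0)) h0 h1 hs _; ring.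
    - by apply: Or31; apply: (comb (-1) (-1) (2)) h0 h1 hs _; ring.
  have mid (t : algC) : t \in X -> y + a1 - 2 * t = 0 -> False.
    move=> ct /subr0_eq Dt; apply: ne_ya.
    apply: (no_midpoint (alpha := alpha)) Dt => w.
    rewrite !inE => /or3P[] /eqP-> //; apply: memX;
      by rewrite ?in_cons eqxx ?orbT.
  case: dich => [/subr0_eq // | |].
    by apply/mid/memX; rewrite !inE eqxx ?orbT.
  by apply/mid/memX; rewrite !inE eqxx ?orbT.
have mem_z: z \in [:: a; b; c; d].
  have [u [v [uniq_z sub_z _]]] := mate_xz.
  have cz: z \in X by rewrite sub_z // !inE eqxx ?orbT.
  move: uniq_z; rewrite (perm_mem perm_X) 2!in_cons in cz.
  rewrite [z == y]eq_sym (negPf ne_yz) in cz.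
  by case/orP: cz => [/eqP-> | //]; rewrite /= !inE eqxx.
have sum_cd: x + y + 2 * (c + d) = 0.
  have := sextic_sum perm_X; move/(congr1 ( *%R 2)); rewrite mulr0 => sum_X.
  by rewrite -[RHS]sum_X -[LHS]add0r -[in LHS]sum_s; ring.
move: mem_z; rewrite !inE => /or4P[] /eqP Dz; rewrite {z}Dz in mate_xz ne_yz *.
- by case: (no_mate a b c d).
- case: (no_mate b a c d) => //; last by rewrite [b + a]addrC.
  by apply: perm_trans perm_X _; apply/permP=> P /=; lia.
- case: (no_mate c d a b) => //.
  by apply: perm_trans perm_X _; apply/permP=> P /=; lia.
- case: (no_mate d c a b) => //; last by rewrite [d + c]addrC.
  by apply: perm_trans perm_X _; apply/permP=> P /=; lia.
Qed.

Lemma relation_complement_mates (x1 x2 x3 x4 : algC) :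
    uniq [:: x1; x2; x3; x4] -> {subset [:: x1; x2; x3; x4] <= X} ->
    x1 + x2 = x3 + x4 ->
  exists u v, mate u v /\ u + v + 2 * (x1 + x2) = 0.
Proof.
move=> uniq_s sub_s Dx.
have [u [v perm_X]] := sextic_complete uniq_s sub_s.
have sum_uv : u + v + 2 * (x1 + x2) = 0.
  have ->: 2 * (x1 + x2) = x1 + x2 + (x3 + x4) by rewrite -Dx; ring.
  by rewrite -[RHS](sextic_sum perm_X); ring.
have perm_X': perm_eq X ([:: u; v; x1; x2] ++ [:: x3; x4]).
  apply: perm_trans perm_X _.
  exact: permEl (perm_catC [:: x1; x2; x3; x4] [:: u; v]).
exists u, v; split; last exact: sum_uv.
exists x1, x2; split; last exact: sum_uv.
  have := conjugates_uniq alpha; rewrite (perm_uniq perm_X') cat_uniq.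
  by case/andP.
by move=> t mem_t; rewrite (perm_mem perm_X') mem_cat mem_t.
Qed.

(** Transitivity carries one pair of mates over any given conjugate. *)
Lemma mate_exists (x1 x2 x3 x4 x : algC) :
    uniq [:: x1; x2; x3; x4] -> {subset [:: x1; x2; x3; x4] <= X} ->
    x1 + x2 = x3 + x4 -> x \in X ->
  exists y, mate x y.
Proof.
move=> uniq_s sub_s Dx cx.
have [u [v [mate_uv _]]] := relation_complement_mates uniq_s sub_s Dx.
have cu: u \in X.
  by case: mate_uv => [a [b [_ sub_u _]]]; rewrite sub_u // inE eqxx.
have [nu <-] := conjugates_transitive cu cx.
by exists (nu v); apply: mate_aut.
Qed.

(** That s and t are mates means that x, y, u, v split into two pairs of equal
    sum; the three possible splittings give the sum, the difference, or the
    difference up to sign. *)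
Lemma mates_dichotomy (x y u v s t : algC) :
    perm_eq X [:: x; y; u; v; s; t] -> mate s t ->
  x + y = u + v \/ (x - y) ^+ 2 = (u - v) ^+ 2.
Proof.
move=> perm_X [a [b [uniq_s sub_s sum_s]]].
have sum_X := sextic_sum perm_X.
have split_eq (c d : algC) : x + y + u + v = a + b + (c + d) -> a + b = c + d.
  move=> Dsum; apply/subr0_eq; rewrite -[RHS](subr0 0) -{1}sum_s -sum_X.
  have ->: x + y + u + v + s + t = a + b + (c + d) + s + t by rewrite Dsum.
  by ring.
have [ca cb]: a \in X /\ b \in X by rewrite !sub_s // !inE eqxx ?orbT.
rewrite !(perm_mem perm_X) !inE in ca cb; move: uniq_s.
rewrite /= !inE !negb_or => /and4P[/and3P[_ nsa nsb] /andP[nta ntb] nab _].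
rewrite ![s == _]eq_sym in nsa nsb; rewrite ![t == _]eq_sym in nta ntb.
rewrite (negPf nsa) (negPf nta) !orbF in ca.
rewrite (negPf nsb) (negPf ntb) !orbF in cb.
have sqD : x + u = y + v \/ x + v = y + u -> (x - y) ^+ 2 = (u - v) ^+ 2.
  case=> /(canRL (addrK _)) ->; last by congr (_ ^+ 2); ring.
  by rewrite -[RHS]sqrrN; congr (_ ^+ 2); ring.
case/or4P: ca => /eqP Da; case/or4P: cb => /eqP Db;
  rewrite Da Db ?eqxx // in nab split_eq.
- by left; apply: split_eq; ring.
- by right; apply: sqD; left; apply: split_eq; ring.
- by right; apply: sqD; right; apply: split_eq; ring.
- by left; rewrite addrC; apply: split_eq; ring.
- by right; apply: sqD; right; apply/esym; apply: split_eq; ring.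
- by right; apply: sqD; left; apply/esym; apply: split_eq; ring.
- by right; apply: sqD; left; rewrite addrC; apply: split_eq; ring.
- by right; apply: sqD; right; apply/esym; rewrite addrC; apply: split_eq; ring.
- by left; apply/esym; apply: split_eq; ring.
- by right; apply: sqD; right; rewrite addrC; apply: split_eq; ring.
- by right; apply: sqD; left; apply/esym; rewrite addrC; apply: split_eq; ring.
- by left; apply/esym; rewrite addrC; apply: split_eq; ring.
Qed.

(** Existence and uniqueness of mates make the mate relation a fixed-point-free
    involution on the six conjugates. *)
Lemma sextic_mate_pairs (z1 z2 z3 z4 : algC) :
    uniq [:: z1; z2; z3; z4] -> {subset [:: z1; z2; z3; z4] <= X} ->
    z1 + z2 = z3 + z4 ->
  exists x y u v s t : algC, [/\ perm_eq X [:: x; y; u; v; s; t],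
    mate x y, mate u v & mate s t].
Proof.
move=> uniq_z sub_z Dz; have ex_mate w := mate_exists (x := w) uniq_z sub_z Dz.
have mateP w w' : mate w w' -> [/\ w \in X, w' \in X & w != w'].
  case=> [a [b [uniq_s sub_s _]]].
  split; try by apply: sub_s; rewrite !inE eqxx ?orbT.
  by move: uniq_s; rewrite /= !inE negb_or => /andP[/andP[]].
have cx: z1 \in X by rewrite sub_z // inE eqxx.
have [y mate_xy] := ex_mate _ cx.
have [_ cy ne_xy] := mateP _ _ mate_xy.
have [p [q [uniq_p sub_p _]]] := mate_xy.
have [p' [q' perm_p]] := sextic_complete uniq_p sub_p.
have cu: p \in X by rewrite sub_p // !inE eqxx ?orbT.
have [ne_px ne_py] : p != z1 /\ p != y.
  move: uniq_p; rewrite /= !inE !negb_or ![_ == p]eq_sym.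
  by case/and3P=> /and3P[_ -> _] /andP[-> _].
have [v mate_uv] := ex_mate _ cu.
have [_ cv ne_uv] := mateP _ _ mate_uv.
have ne_xv: z1 != v.
  apply: contraNneq ne_py => Dv; rewrite -Dv in mate_uv.
  by rewrite (mate_uniq (mateC mate_uv) mate_xy).
have ne_yv: y != v.
  apply: contraNneq ne_px => Dv; rewrite -Dv in mate_uv.
  by rewrite (mate_uniq (mateC mate_uv) (mateC mate_xy)).
have [s [t perm_X]]: exists s t, perm_eq X [:: z1; y; p; v; s; t].
  apply: sextic_complete.
    rewrite /= !inE !negb_or ne_xy ne_xv ne_yv ne_uv !andbT.
    by rewrite ![_ == p]eq_sym ne_px.
  by move=> w; rewrite !inE => /or4P[] /eqP->.
have cs: s \in X by rewrite (perm_mem perm_X) !inE eqxx ?orbT.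
have [w mate_sw] := ex_mate _ cs; have [_ cw ne_sw] := mateP _ _ mate_sw.
have := conjugates_uniq alpha; rewrite (perm_uniq perm_X) /= !inE !negb_or.
case/and5P=> /and5P[_ _ _ nxs _] /and4P[_ _ nys _] /and3P[_ nps _].
move=> /andP[nvs _] _.
exists z1, y, p, v, s, t; split => //.
(* The mate of s is t: the mates of the four others are already known. *)
have := cw; rewrite (perm_mem perm_X) !inE.
case/or4P=> [|||/or3P[]] /eqP Dw; rewrite Dw in mate_sw => //.
- by rewrite (mate_uniq (mateC mate_sw) mate_xy) eqxx in nys.
- by rewrite (mate_uniq (mateC mate_sw) (mateC mate_xy)) eqxx in nxs.
- by rewrite (mate_uniq (mateC mate_sw) mate_uv) eqxx in nvs.
- by rewrite (mate_uniq (mateC mate_sw) (mateC mate_uv)) eqxx in nps.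
- by rewrite Dw eqxx in ne_sw.
Qed.

Lemma eq_sum_neq_diff (x y u v : algC) :
  x != u -> x != v -> x + y = u + v -> (x - y) ^+ 2 <> (u - v) ^+ 2.
Proof.
move=> ne_xu ne_xv Ds /eqP; rewrite -subr_eq0.
have ->: y = u + v - x by rewrite -Ds addrC addKr.
have ->: (x - (u + v - x)) ^+ 2 - (u - v) ^+ 2 = 4 * ((x - u) * (x - v)).
  by ring.
by rewrite !mulf_eq0 pnatr_eq0 !subr_eq0 (negPf ne_xu) (negPf ne_xv).
Qed.

(** A single equality of sums spreads to all three pairs, since equal sums
    exclude equal squared differences; the sums are then 0, which makes
    z1 + z2 equal to 0. So the squared differences agree; their common value is
    rational because automorphisms preserve the mate relation. *)
Lemma sextic_equal_gaps (z1 z2 z3 z4 : algC) :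
    uniq [:: z1; z2; z3; z4] -> {subset [:: z1; z2; z3; z4] <= X} ->
    z1 + z2 = z3 + z4 -> z1 + z2 \notin Crat ->
  exists x y u v s t : algC,
    [/\ perm_eq X [:: x; y; u; v; s; t],
        (x - y) ^+ 2 \in Crat, (u - v) ^+ 2 = (x - y) ^+ 2
      & (s - t) ^+ 2 = (x - y) ^+ 2].
Proof.
move=> uniq_z sub_z Dz irr_z.
have [x [y [u [v [s [t [perm_X mxy muv mst]]]]]]] :=
  sextic_mate_pairs uniq_z sub_z Dz.
have sum_X := sextic_sum perm_X.
have dich_xu := mates_dichotomy perm_X mst.
have dich_xs : x + y = s + t \/ (x - y) ^+ 2 = (s - t) ^+ 2.
  apply: (mates_dichotomy _ muv); apply: perm_trans perm_X _.
  by rewrite !perm_cons; apply: permEl (perm_catC [:: u; v] [:: s; t]).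
have dich_us : u + v = s + t \/ (u - v) ^+ 2 = (s - t) ^+ 2.
  apply: (mates_dichotomy _ mxy); apply: perm_trans perm_X _.
  exact: permEl (perm_catC [:: x; y] [:: u; v; s; t]).
have := conjugates_uniq alpha; rewrite (perm_uniq perm_X) /= !inE !negb_or.
case/and5P=> /and5P[_ nxu nxv nxs nxt] _ _ _ _.
have excl_xu := eq_sum_neq_diff nxu nxv (y := y).
have excl_xs := eq_sum_neq_diff nxs nxt (y := y).
have [[Suv Sst] | [Duv Dst]] :
    (u + v = x + y /\ s + t = x + y) \/
    ((u - v) ^+ 2 = (x - y) ^+ 2 /\ (s - t) ^+ 2 = (x - y) ^+ 2).
  case: dich_xu => exu; case: dich_xs => exs; [by left | | | by right].
    case: dich_us => eus; first by case: excl_xs => //; rewrite exu.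
    by case: excl_xu => //; rewrite exs.
  case: dich_us => eus; first by case: excl_xu => //; rewrite eus.
  by case: excl_xs => //; rewrite exu.
- have sum0 : x + y = 0.
    apply/eqP; have: 3 * (x + y) = 0.
      rewrite -[RHS]sum_X -!addrA Sst [u + (v + _)]addrA Suv; ring.
    by move/eqP; rewrite mulf_eq0 pnatr_eq0.
  have mate_opp w w' : mate w w' -> w + w' = 0.
    move=> mw; have cw: w \in X.
      by case: mw => [a [b [_ sub_w _]]]; rewrite sub_w // inE eqxx.
    move: cw; rewrite (perm_mem perm_X) !inE.
    case/or4P=> [|||/or3P[]] /eqP Dw; rewrite Dw in mw *.
    - by rewrite (mate_uniq mw mxy).
    - by rewrite (mate_uniq mw (mateC mxy)) addrC.
    - by rewrite (mate_uniq mw muv) Suv.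
    - by rewrite (mate_uniq mw (mateC muv)) addrC Suv.
    - by rewrite (mate_uniq mw mst) Sst.
    - by rewrite (mate_uniq mw (mateC mst)) addrC Sst.
  have [z5 [z6 [mz Dz56]]] := relation_complement_mates uniq_z sub_z Dz.
  case/negP: irr_z; move/eqP: Dz56; rewrite (mate_opp _ _ mz) add0r mulf_eq0.
  by rewrite pnatr_eq0 => /eqP->.
exists x, y, u, v, s, t; split=> //; apply: aut_fixed_Crat => nu.
rewrite rmorphXn rmorphB /=; have mnu := mate_aut nu mxy.
have: nu x \in X by apply: aut_conjugates; rewrite (perm_mem perm_X) inE eqxx.
rewrite (perm_mem perm_X) !inE.
case/or4P=> [|||/or3P[]] /eqP Dw; rewrite Dw in mnu *.
- by rewrite (mate_uniq mnu mxy).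
- by rewrite (mate_uniq mnu (mateC mxy)) -sqrrN opprB.
- by rewrite (mate_uniq mnu muv).
- by rewrite (mate_uniq mnu (mateC muv)) -sqrrN opprB.
- by rewrite (mate_uniq mnu mst).
- by rewrite (mate_uniq mnu (mateC mst)) -sqrrN opprB.
Qed.

End SexticMates.

(** * Shape of the minimal polynomial *)

(** The sextic over the algebraic numbers, with the a, b, c read off from the
    roots before they are known to be rational. *)
Definition split_sextic_poly (a b c : algC) : {poly algC} :=
  'X^6 + (2 * b - 3 * a)%:P * 'X^4 + (2 * c)%:P * 'X^3
  + (3 * a ^+ 2 + b ^+ 2)%:P * 'X^2 + (2 * c * (3 * a + b))%:P * 'X
  + (- a ^+ 3 - 2 * a ^+ 2 * b - a * b ^+ 2 + c ^+ 2)%:P.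

Lemma map_split_sextic (f : {rmorphism rat -> algC}) (a b c : rat) :
  map_poly f (split_sextic a b c) = split_sextic_poly (f a) (f b) (f c).
Proof.
apply/polyP=> i; rewrite coef_map /split_sextic /split_sextic_poly.
rewrite !(coefD, coefZ, coefCM, coefXn, coefX, coefC) /=.
by case: (i == 0)%N; ring.
Qed.

Lemma QtoC_split_sextic (a b c : rat) :
  QtoC_poly (split_sextic a b c) = split_sextic_poly (ratr a) (ratr b) (ratr c).
Proof. exact: map_split_sextic. Qed.

(** With s a square root of a, the roots are m_i + s and m_i - s; the other two
    parameters are those of the cubic X^3 + b X + c with roots m_i. *)
Lemma split_sextic_factor (a m1 m2 m3 : algC) : m1 + m2 + m3 = 0 ->
  (('X - m1%:P) ^+ 2 - a%:P) * (('X - m2%:P) ^+ 2 - a%:P)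
    * (('X - m3%:P) ^+ 2 - a%:P) =
  split_sextic_poly a (m1 * m2 + m1 * m3 + m2 * m3) (- (m1 * m2 * m3)).
Proof.
move=> sum0; have ->: m3 = - (m1 + m2).
  by apply/eqP; rewrite -addr_eq0 addrC sum0.
rewrite /split_sextic_poly.
by ring.
Qed.

Lemma coef_split_sextic (a b c : algC) :
  ((split_sextic_poly a b c)`_4 = 2 * b - 3 * a) *
  ((split_sextic_poly a b c)`_3 = 2 * c).
Proof.
by split; rewrite /split_sextic_poly !(coefD, coefCM, coefXn, coefX, coefC) /=;
  rewrite ?mulr0 ?mulr1 ?addr0 ?add0r.
Qed.

Lemma Crat_minCpoly_coef (alpha : algC) (i : nat) :
  (minCpoly alpha)`_i \in Crat.
Proof.
by have [p [-> _] _] := minCpolyP alpha; rewrite coef_map Crat_rat.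
Qed.

(** Each pair of mates x, y contributes the factor (X - m)^2 - A, where m is its
    midpoint and 4 A the common squared difference. As A is rational, the
    coefficients of degree 4 and 3 give the rationality of the other two
    parameters. *)
Lemma sextic_split_form (alpha z1 z2 z3 z4 : algC) :
    algdegree alpha = 6%N -> abs_trace alpha = 0 ->
    uniq [:: z1; z2; z3; z4] ->
    {subset [:: z1; z2; z3; z4] <= conjugates alpha} ->
    z1 + z2 = z3 + z4 -> z1 + z2 \notin Crat ->
  exists a b c, minCpoly alpha = QtoC_poly (split_sextic a b c).
Proof.
move=> deg6 tr0 uniq_z sub_z Dz irr_z.
have [x [y [u [v [s [t [perm_X rat_gap gap_uv gap_st]]]]]]] :=
  sextic_equal_gaps deg6 tr0 uniq_z sub_z Dz irr_z.
pose A := (x - y) ^+ 2 / 4; pose m1 := (x + y) / 2; pose m2 := (u + v) / 2.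
pose m3 := (s + t) / 2.
have nz2 : 2 != 0 :> algC by rewrite pnatr_eq0.
have factor (w w' : algC) : (w - w') ^+ 2 = (x - y) ^+ 2 ->
    ('X - w%:P) * ('X - w'%:P) = ('X - ((w + w') / 2)%:P) ^+ 2 - A%:P.
  move=> gap; have -> : A = ((w + w') / 2) ^+ 2 - w * w'.
    by rewrite /A -gap; field.
  set m := (w + w') / 2; have -> : w' = m + m - w by rewrite /m; field.
  by ring.
have sum0 : m1 + m2 + m3 = 0.
  rewrite -[RHS](mul0r 2^-1) -(sextic_sum tr0 perm_X) /m1 /m2 /m3; ring.
have Dp : minCpoly alpha =
    split_sextic_poly A (m1 * m2 + m1 * m3 + m2 * m3) (- (m1 * m2 * m3)).
  rewrite -split_sextic_factor // conjugatesE (perm_big _ perm_X).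
  rewrite !big_cons big_nil /=.
  by rewrite -(factor x y) // -(factor u v) // -(factor s t) // mulr1 !mulrA.
have /CratP[a Da] : A \in Crat by rewrite rpred_div // rpred_nat.
have /CratP[b Db] : m1 * m2 + m1 * m3 + m2 * m3 \in Crat.
  have := Crat_minCpoly_coef alpha 4; rewrite Dp coef_split_sextic => rat4.
  have {1}->: m1 * m2 + m1 * m3 + m2 * m3 =
      (2 * (m1 * m2 + m1 * m3 + m2 * m3) - 3 * A + 3 * A) / 2 by field.
  by rewrite rpred_div ?rpred_nat // rpredD // rpredM ?rpred_nat // Da Crat_rat.
have /CratP[c Dc] : - (m1 * m2 * m3) \in Crat.
  have := Crat_minCpoly_coef alpha 3; rewrite Dp coef_split_sextic => rat3.
  have ->: - (m1 * m2 * m3) = 2 * - (m1 * m2 * m3) / 2 by field.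
  by rewrite rpred_div ?rpred_nat.
by exists a, b, c; rewrite QtoC_split_sextic Dp Da Db Dc.
Qed.

Lemma biquadratic_form (alpha : algC) :
    algdegree alpha = 4%N -> {homo -%R : x / x \in conjugates alpha} ->
  exists a b, minCpoly alpha = QtoC_poly (biquadratic a b).
Proof.
move=> deg4 opp_c; have [q [Dq mon_q] _] := minCpolyP alpha.
have size_q : size q = 5%N.
  rewrite -(size_map_poly (ratr : {rmorphism rat -> algC})) -Dq.
  by rewrite -(prednK (ltnW (size_minCpoly alpha))) -/(algdegree alpha) deg4.
exists q`_2, q`_0; rewrite Dq; congr map_poly.
have even4 : ~~ odd (algdegree alpha) by rewrite deg4.
have odd_q i := @opp_closed_odd_coef alpha q i even4 opp_c Dq.
have [q1 q3] := (odd_q 1%N isT, odd_q 3%N isT).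
have := monicP mon_q; rewrite lead_coefE size_q /= => q4.
apply/polyP => -[|[|[|[|[|i]]]]];
  rewrite /biquadratic !(coefD, coefZ, coefXn, coefC) /=;
  rewrite ?mulr0 ?mulr1 ?addr0 ?add0r ?q1 ?q3 ?q4 //.
by rewrite nth_default ?size_q.
Qed.

Lemma even_sextic_form (alpha : algC) :
    algdegree alpha = 6%N -> {homo -%R : x / x \in conjugates alpha} ->
  exists a b c, minCpoly alpha = QtoC_poly (even_sextic a b c).
Proof.
move=> deg6 opp_c; have [q [Dq mon_q] _] := minCpolyP alpha.
have size_q : size q = 7%N.
  rewrite -(size_map_poly (ratr : {rmorphism rat -> algC})) -Dq.
  by rewrite -(prednK (ltnW (size_minCpoly alpha))) -/(algdegree alpha) deg6.
exists q`_4, q`_2, q`_0; rewrite Dq; congr map_poly.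
have even6 : ~~ odd (algdegree alpha) by rewrite deg6.
have odd_q i := @opp_closed_odd_coef alpha q i even6 opp_c Dq.
have [q1 q3] := (odd_q 1%N isT, odd_q 3%N isT).
have q5 := odd_q 5%N isT.
have := monicP mon_q; rewrite lead_coefE size_q /= => q6.
apply/polyP => -[|[|[|[|[|[|[|i]]]]]]];
  rewrite /even_sextic !(coefD, coefZ, coefXn, coefC) /=;
  rewrite ?mulr0 ?mulr1 ?addr0 ?add0r ?q1 ?q3 ?q5 ?q6 //.
by rewrite nth_default ?size_q.
Qed.

(** An automorphism sending x to z sends y to r - z, where r = x + y. Summing
    over the conjugates, which z |-> r - z permutes, gives r = 0. *)
Lemma rational_sum_opp_closed (alpha x y : algC) :
    abs_trace alpha = 0 -> x \in conjugates alpha -> y \in conjugates alpha ->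
    x + y \in Crat ->
  {homo -%R : z / z \in conjugates alpha}.
Proof.
move=> tr0 cx cy rat_xy; set r := x + y in rat_xy.
have refl_c z : z \in conjugates alpha -> r - z \in conjugates alpha.
  move=> cz; have [nu Dz] := conjugates_transitive cx cz.
  have -> : r - z = nu y.
    by rewrite -Dz -(aut_Crat nu rat_xy) rmorphD addrC addKr.
  exact: aut_conjugates.
have perm_refl : perm_eq (conjugates alpha) [seq r - z | z <- conjugates alpha].
  apply: perm_eq_sub; rewrite ?conjugates_uniq ?size_map //.
    by rewrite map_inj_uniq ?conjugates_uniq // => z w /addrI/oppr_inj.
  by move=> _ /mapP[z cz ->]; apply: refl_c.
have r0 : r = 0.
  have: abs_trace alpha = r *+ algdegree alpha - abs_trace alpha.
    rewrite {1}/abs_trace (perm_big _ perm_refl) big_map sumrB.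
    by rewrite big_const_seq count_predT iter_addr_0 size_conjugates.
  rewrite tr0 subr0 => /esym/eqP; rewrite mulrn_eq0 -size_conjugates size_eq0.
  by case: (conjugates alpha) cx => //= ? ? _ /eqP.
by move=> z /refl_c; rewrite r0 sub0r.
Qed.

(** * Existence of the relation *)

(** Any nonzero x and any nonzero y other than x and -x give the relation
    x + (-x) = y + (-y). *)
Lemma opp_closed_relation (alpha : algC) :
    (4 <= algdegree alpha)%N -> {homo -%R : x / x \in conjugates alpha} ->
  exists x1 x2 x3 x4, [/\ uniq [:: x1; x2; x3; x4],
    {subset [:: x1; x2; x3; x4] <= conjugates alpha} & x1 + x2 = x3 + x4].
Proof.
rewrite -size_conjugates => size_c opp_c.
have pick (s : seq algC) : (size s <= 3)%N ->
    exists2 x, x \in conjugates alpha & x \notin s.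
  move=> size_s; apply/hasP; rewrite has_predC; apply/negP => /allP sub_cs.
  have := uniq_leq_size (conjugates_uniq alpha) sub_cs.
  by rewrite leqNgt (leq_ltn_trans size_s).
have [x cx] := pick [:: 0] isT; rewrite inE => nz_x.
have [y cy] := pick [:: 0; x; - x] isT.
rewrite !inE !negb_or => /and3P[nz_y ne_yx ne_yNx].
have opp_neq (z : algC) : z != 0 -> (z == - z) = false.
  by move=> nz_z; rewrite -addr_eq0 -mulr2n mulrn_eq0 (negPf nz_z).
exists x, (- x), y, (- y); split; last by rewrite !subrr.
  rewrite /= !inE !negb_or !opp_neq // eqr_opp -eqr_oppLR.
  by rewrite [x == y]eq_sym [- x == y]eq_sym ne_yx ne_yNx.
by move=> z; rewrite !inE => /or4P[] /eqP->; rewrite ?opp_c.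
Qed.

Lemma monic_Xn_add (n : nat) (r : {poly rat}) : (size r <= n)%N ->
  ('X^n + r \is monic) * (size ('X^n + r) = n.+1).
Proof.
move=> le_rn; have lt_r: (size r < size ('X^n : {poly rat}))%N.
  by rewrite size_polyXn ltnS.
by split; rewrite ?monicE ?lead_coefDl ?size_polyDl ?size_polyXn ?lead_coefXn.
Qed.

Lemma biquadratic_monic (a b : rat) :
  (biquadratic a b \is monic) * (size (biquadratic a b) = 5%N).
Proof.
rewrite /biquadratic -addrA; apply: monic_Xn_add; apply/leq_sizeP => j le_j.
rewrite !(coefD, coefZ, coefXn, coefC).
by do 4![case: j le_j => [//|j le_j]]; rewrite !mulr0 !addr0.
Qed.

Lemma even_sextic_monic (a b c : rat) :
  (even_sextic a b c \is monic) * (size (even_sextic a b c) = 7%N).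
Proof.
rewrite /even_sextic -!addrA; apply: monic_Xn_add; apply/leq_sizeP => j le_j.
rewrite !(coefD, coefZ, coefXn, coefC).
by do 6![case: j le_j => [//|j le_j]]; rewrite !mulr0 !addr0.
Qed.

Lemma split_sextic_monic (a b c : rat) :
  (split_sextic a b c \is monic) * (size (split_sextic a b c) = 7%N).
Proof.
rewrite /split_sextic -!addrA; apply: monic_Xn_add; apply/leq_sizeP => j le_j.
rewrite !(coefD, coefZ, coefXn, coefX, coefC).
by do 6![case: j le_j => [//|j le_j]]; rewrite !mulr0 !addr0.
Qed.

Lemma algdegree_minCpoly (alpha : algC) (q : {poly rat}) (n : nat) :
  minCpoly alpha = QtoC_poly q -> size q = n.+1 -> algdegree alpha = n.
Proof. by rewrite /algdegree => -> /= Dq; rewrite size_map_poly Dq. Qed.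

Lemma even_relation (q : {poly rat}) (n : nat) :
    irreducible_poly q -> q \is monic -> size q = n.+1 -> (4 <= n)%N ->
    (forall x, (QtoC_poly q).[- x] = (QtoC_poly q).[x]) ->
  exists x1 x2 x3 x4 : algC,
    [/\ uniq [:: x1; x2; x3; x4], all (root (QtoC_poly q)) [:: x1; x2; x3; x4]
      & x1 + x2 = x3 + x4].
Proof.
move=> irr_q mon_q size_q le4n even_q.
have [alpha Dq] := irreducible_minCpoly irr_q mon_q.
have mem_q z : (z \in conjugates alpha) = root (QtoC_poly q) z.
  by rewrite mem_conjugates Dq.
have [||x1 [x2 [x3 [x4 [uniq_x sub_x Dx]]]]] := @opp_closed_relation alpha.
- by rewrite (algdegree_minCpoly Dq size_q).
- by move=> x; rewrite !mem_q /root even_q.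
by exists x1, x2, x3, x4; split=> //; apply/allP => z /sub_x; rewrite mem_q.
Qed.

(** The roots are m_i + s and m_i - s; they are distinct because they are the
    conjugates of one of them. *)
Lemma split_sextic_relation (a b c : rat) :
    irreducible_poly (split_sextic a b c) ->
  exists x1 x2 x3 x4 : algC,
    [/\ uniq [:: x1; x2; x3; x4],
        all (root (QtoC_poly (split_sextic a b c))) [:: x1; x2; x3; x4]
      & x1 + x2 = x3 + x4].
Proof.
move=> irr_q; have [mon_q _] := split_sextic_monic a b c.
have [alpha Dq] := irreducible_minCpoly irr_q mon_q.
pose s : algC := sqrtC (ratr a); have Ds : s ^+ 2 = ratr a by rewrite sqrtCK.
pose C : {poly rat} := 'X^3 + (b *: 'X + c%:P).
have [mon_C size_C] : (C \is monic) * (size C = 4%N).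
  apply: monic_Xn_add; apply/leq_sizeP => j le_j.
  rewrite !(coefD, coefZ, coefX, coefC).
  by do 3![case: j le_j => [//|j le_j]]; rewrite !mulr0 !addr0.
have [r] := closed_field_poly_normal (QtoC_poly C).
rewrite (monicP _) ?map_monic // scale1r => DC.
have size_r : size r = 3%N.
  by apply/eqP; rewrite -eqSS -(size_prod_XsubC r id) -DC size_map_poly size_C.
case: r size_r DC => [|m1 [|m2 [|m3 []]]] // _.
rewrite !big_cons big_nil mulr1 => DC.
have coefQ i : (QtoC_poly C)`_i = ratr (C`_i) by rewrite coef_map.
have DC' : ('X - m1%:P) * (('X - m2%:P) * ('X - m3%:P)) = 'X^3
     - (m1 + m2 + m3)%:P * 'X^2 + (m1 * m2 + m1 * m3 + m2 * m3)%:P * 'X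
     - (m1 * m2 * m3)%:P by ring.
rewrite DC' in DC.
have coefs i : ratr C`_i = ('X^3 - (m1 + m2 + m3)%:P * 'X^2
    + (m1 * m2 + m1 * m3 + m2 * m3)%:P * 'X - (m1 * m2 * m3)%:P)`_i.
  by rewrite -coefQ DC.
have sum0 : m1 + m2 + m3 = 0.
  have := coefs 2%N.
  rewrite /C !(coefB, coefD, coefZ, coefCM, coefXn, coefX, coefC) /=.
  rewrite !mulr0 !mulr1 !addr0 !subr0 !sub0r rmorph0 => /esym/eqP.
  by rewrite oppr_eq0 => /eqP.
have Db : ratr b = m1 * m2 + m1 * m3 + m2 * m3.
  have := coefs 1%N.
  rewrite /C !(coefB, coefD, coefZ, coefCM, coefXn, coefX, coefC) /=.
  by rewrite !mulr0 !mulr1 !addr0 !subr0 !add0r.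
have Dc : ratr c = - (m1 * m2 * m3).
  have := coefs 0%N.
  rewrite /C !(coefB, coefD, coefZ, coefCM, coefXn, coefX, coefC) /=.
  by rewrite !mulr0 ?addr0 ?subr0 ?add0r ?sub0r.
have Dp : QtoC_poly (split_sextic a b c) = \prod_(z <- [:: m1 + s; m1 - s;
    m2 + s; m2 - s; m3 + s; m3 - s]) ('X - z%:P).
  rewrite QtoC_split_sextic Db Dc -split_sextic_factor // -Ds !big_cons big_nil.
  by ring.
have uniq_X : uniq [:: m1 + s; m1 - s; m2 + s; m2 - s; m3 + s; m3 - s].
  rewrite -separable_prod_XsubC -Dp -Dq conjugatesE separable_prod_XsubC.
  exact: conjugates_uniq.
exists (m1 + s), (m2 - s), (m1 - s), (m2 + s); split; last by ring.
  have perm4 : perm_eq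
      ([:: m1 + s; m2 - s; m1 - s; m2 + s] ++ [:: m3 + s; m3 - s])
      [:: m1 + s; m1 - s; m2 + s; m2 - s; m3 + s; m3 - s].
    by apply/permP => P /=; clear; lia.
  by move: uniq_X; rewrite -(perm_uniq perm4) cat_uniq => /andP[].
apply/allP => z; rewrite Dp root_prod_XsubC !inE.
by case/or4P => ->; rewrite ?orbT.
Qed.

Theorem theorem2 :
  (forall alpha x1 x2 x3 x4 : algC,
     algdegree alpha \in [:: 4; 5; 6; 7]%N ->
     abs_trace alpha = 0 ->
     uniq [:: x1; x2; x3; x4] ->
     {subset [:: x1; x2; x3; x4] <= conjugates alpha} ->
     x1 + x2 = x3 + x4 ->
     [/\ algdegree alpha = 4%N \/ algdegree alpha = 6%N,
         algdegree alpha = 4%N ->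
         exists a b : rat,
           irreducible_poly (biquadratic a b) /\
           minCpoly alpha = QtoC_poly (biquadratic a b),
         algdegree alpha = 6%N -> x1 + x2 \in Crat ->
         exists a b c : rat,
           irreducible_poly (even_sextic a b c) /\
           minCpoly alpha = QtoC_poly (even_sextic a b c)
       & algdegree alpha = 6%N -> x1 + x2 \notin Crat ->
         exists a b c : rat,
           irreducible_poly (split_sextic a b c) /\
           minCpoly alpha = QtoC_poly (split_sextic a b c)]) /\
  [/\ forall a b : rat, irreducible_poly (biquadratic a b) ->
        exists x1 x2 x3 x4 : algC,
          [/\ uniq [:: x1; x2; x3; x4],
              all (root (QtoC_poly (biquadratic a b))) [:: x1; x2; x3; x4]
            & x1 + x2 = x3 + x4],
      forall a b c : rat, irreducible_poly (even_sextic a b c) ->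
        exists x1 x2 x3 x4 : algC,
          [/\ uniq [:: x1; x2; x3; x4],
              all (root (QtoC_poly (even_sextic a b c))) [:: x1; x2; x3; x4]
            & x1 + x2 = x3 + x4]
    & forall a b c : rat, irreducible_poly (split_sextic a b c) ->
        exists x1 x2 x3 x4 : algC,
          [/\ uniq [:: x1; x2; x3; x4],
              all (root (QtoC_poly (split_sextic a b c))) [:: x1; x2; x3; x4]
            & x1 + x2 = x3 + x4]].
Proof.
split=> [alpha x1 x2 x3 x4 deg tr0 uniq_x sub_x Dx | ].
  have c1 : x1 \in conjugates alpha by rewrite sub_x // inE eqxx.
  have c2 : x2 \in conjugates alpha by rewrite sub_x // !inE eqxx orbT.
  split=> [|deg4|deg6 rat_x|deg6 irr_x].
  - have no_prime : ~ prime (algdegree alpha).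
      by move=> p_pr; apply: (prime_degree_no_relation p_pr tr0 uniq_x sub_x).
    move: deg; rewrite !inE => /or4P[] /eqP Dd; [by left | | by right | ];
      by case: no_prime; rewrite Dd.
  - have [r perm_x] := perm_eq_extend uniq_x (conjugates_uniq alpha) sub_x.
    rewrite size_conjugates deg4 => /size0nil r0; rewrite r0 in perm_x.
    have sum0 : x1 + x2 = 0.
      have: 2 * (x1 + x2) = 0.
        rewrite -[RHS]tr0 /abs_trace (perm_big _ perm_x) !big_cons big_nil /=.
        by rewrite addr0 -Dx; ring.
      by move/eqP; rewrite mulf_eq0 pnatr_eq0 => /eqP.
    have [|a [b Dp]] := biquadratic_form deg4.
      by apply: rational_sum_opp_closed tr0 c1 c2 _; rewrite sum0 rpred0.
    by exists a, b; split=> //; apply: minCpoly_irreducible Dp.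
  - have [|a [b [c Dp]]] := even_sextic_form deg6.
      exact: rational_sum_opp_closed tr0 c1 c2 rat_x.
    by exists a, b, c; split=> //; apply: minCpoly_irreducible Dp.
  - have [a [b [c Dp]]] := sextic_split_form deg6 tr0 uniq_x sub_x Dx irr_x.
    by exists a, b, c; split=> //; apply: minCpoly_irreducible Dp.
split=> [a b irr|a b c irr|a b c]; last exact: split_sextic_relation.
- have [mon_q size_q] := biquadratic_monic a b.
  apply: even_relation irr mon_q size_q isT _ => x.
  rewrite /QtoC_poly /biquadratic !rmorphD /= !map_polyZ !map_polyXn map_polyC.
  by rewrite !hornerD !hornerZ !hornerXn !hornerC /=; ring.
- have [mon_q size_q] := even_sextic_monic a b c.
  apply: even_relation irr mon_q size_q isT _ => x.
  rewrite /QtoC_poly /even_sextic !rmorphD /= !map_polyZ !map_polyXn map_polyC.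
  by rewrite !hornerD !hornerZ !hornerXn !hornerC /=; ring.
Qed.
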